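(* Let $G=(V,E^S\cup E^R)$ be a social-request graph with request capacities $R_{ij}>0$ ($e^R_{ij}\in E^R$) and social capacities $S_{ij}$ ($e^S_{ij}\in E^S$). For each $i\in V$ put \[P_i=\sum_{j:\,e^R_{ji}\in E^R}R_{ji}-\sum_{j:\,e^R_{ij}\in E^R}R_{ij},\qquad P=\sum_{i:\,P_i>0}P_i=-\sum_{i:\,P_i<0}P_i .\] Let $G^{S^+}$ be the extended social graph: the directed graph obtained from the social graph $(V,E^S)$, with edge capacities $S_{ij}$, by adding a source node $s$, a destination node $t$, a directed edge of capacity $P_i$ from $s$ to $i$ for each $i$ with $P_i>0$, and a directed edge of capacity $-P_i$ from $i$ to $t$ for each $i$ with $P_i<0$. Then all sensing requests can be satisfied under STAR (that is, there is a feasible set of balanced flows along STAR cycles whose aggregate flow satisfies $f^R_{ij}=R_{ij}$ for every $e^R_{ij}\in E^R$) if and only if the maximum flow value from $s$ to $t$ in $G^{S^+}$ is equal to $P$.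
   Context: $V=\{1,\dots,N\}$ is a finite set of users. The request graph $(V,E^R)$ is directed, has no loops, and has at most one request edge $e^R_{ij}$ from $i$ to $j$; $e^R_{ij}\in E^R$ means that $j$ requests service from $i$, in the amount $R_{ij}>0$. The social graph $(V,E^S)$ is directed, has no loops, and has at most one social edge $e^S_{ij}$ from $i$ to $j$, with capacity $S_{ij}$. Convention: social edges come in pairs, i.e. $e^S_{ij}\in E^S$ iff $e^S_{ji}\in E^S$; a missing reverse edge is represented by an edge of capacity $0$, and all other social capacities are positive. The social-request graph $G=(V,E^S\cup E^R)$ is the directed multigraph containing all request and social edges; a social edge and a request edge between the same nodes are distinct edges. Flows are $D$-valued, where $D=\mathbb{R}$ (divisible service) or $D=\mathbb{Z}$ (indivisible service), and all capacities $R_{ij},S_{ij}$ lie in $D$. A STAR cycle is a (simple) directed cycle in $G$ all of whose edges have positive capacity; it may use social and/or request edges. A balanced flow along a STAR cycle $c$ has the same value $f_c\ge 0$, $f_c\in D$, on each edge of $c$. The aggregate flow of a finite set of balanced flows $\{f_c:c\in\mathcal C\}$ is \[f^S_{ij}=\sum_{c\in\mathcal C:\,e^S_{ij}\in c}f_c-\sum_{c\in\mathcal C:\,e^S_{ji}\in c}f_c,\qquad f^R_{ij}=\sum_{c\in\mathcal C:\,e^R_{ij}\in c}f_c .\] The set is feasible if its aggregate flow satisfies $-S_{ji}\le f^S_{ij}\le S_{ij}$ and $f^S_{ji}=-f^S_{ij}$ for all $e^S_{ij}\in E^S$, and $0\le f^R_{ij}\le R_{ij}$ for all $e^R_{ij}\in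 E^R$. *)

(* Defs.v *)
From HB Require Import structures.
From mathcomp Require Import all_boot all_order all_algebra.
From mathcomp Require Import reals.
Set Implicit Arguments.
Unset Strict Implicit.
Unset Printing Implicit Defensive.
Import Order.TTheory GRing.Theory Num.Theory.
Local Open Scope ring_scope.

(* Divisible service takes amounts in the reals R, indivisible service in the
   integers; capacities and all flows range over the same domain. *)
Inductive service := Divisible | Indivisible.

Definition amount (R : realType) (k : service) : realDomainType :=
  match k with
  | Divisible => (R : realDomainType)
  | Indivisible => (int : realDomainType)
  end.

(* [req] and [soc] are the edge relations E^R and E^S; [rcap] and [scap] are
   the capacities R_ij and S_ij, which are only meaningful on edges.
   [scap_pos] says that an edge of capacity 0 only occurs as the stand-in for
   a missing reverse of an edge of positive capacity. *)
Record srgraph (D : realDomainType) (N : nat) := SRGraph {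
  req : rel 'I_N;
  soc : rel 'I_N;
  rcap : 'I_N -> 'I_N -> D;
  scap : 'I_N -> 'I_N -> D;
  req_irr : irreflexive req;
  soc_irr : irreflexive soc;
  soc_sym : symmetric soc;
  rcap_gt0 : forall i j, req i j -> 0 < rcap i j;
  scap_ge0 : forall i j, soc i j -> 0 <= scap i j;
  scap_pos : forall i j, soc i j -> (0 < scap i j) || (0 < scap j i)
}.

(* Edges of the multigraph: [social i j] and [request i j] are distinct edges
   from i to j, encoded by the two sides of a disjoint sum. *)
Definition edge (N : nat) : finType := (('I_N * 'I_N) + ('I_N * 'I_N))%type.

Notation social i j := (inl (i, j)) (only parsing).
Notation request i j := (inr (i, j)) (only parsing).

Definition tail_node N (e : edge N) : 'I_N :=
  match e with social i _ => i | request i _ => i end.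

Definition head_node N (e : edge N) : 'I_N :=
  match e with social _ j => j | request _ j => j end.

Section StarFlows.
Variables (D : realDomainType) (N : nat) (G : srgraph D N).

Definition in_graph (e : edge N) : bool :=
  match e with social i j => soc G i j | request i j => req G i j end.

Definition capacity (e : edge N) : D :=
  match e with social i j => scap G i j | request i j => rcap G i j end.

(* A cycle is identified with its set of edges, so that it does not depend on
   a starting point; [s] lists these edges in cyclic order, and distinctness
   of their tails expresses that the cycle is simple. *)
Definition star_cycle (c : {set edge N}) : Prop :=
  exists s : seq (edge N),
    [/\ c = [set e in s],
        s != [::],
        cycle (fun e e' => head_node e == tail_node e') s,
        uniq (map (@tail_node N) s)
      & all (fun e => in_graph e && (0 < capacity e)) s].

Definition balanced_flows (C : {set {set edge N}}) (f : {set edge N} -> D) :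
    Prop :=
  forall c, c \in C -> star_cycle c /\ 0 <= f c.

Definition aggS (C : {set {set edge N}}) (f : {set edge N} -> D)
    (i j : 'I_N) : D :=
  \sum_(c in C | social i j \in c) f c - \sum_(c in C | social j i \in c) f c.

Definition aggR (C : {set {set edge N}}) (f : {set edge N} -> D)
    (i j : 'I_N) : D :=
  \sum_(c in C | request i j \in c) f c.

Definition feasible (C : {set {set edge N}}) (f : {set edge N} -> D) : Prop :=
  (forall i j, soc G i j ->
     - scap G j i <= aggS C f i j <= scap G i j /\
     aggS C f j i = - aggS C f i j) /\
  (forall i j, req G i j -> 0 <= aggR C f i j <= rcap G i j).

Definition all_requests_satisfiable : Prop :=
  exists (C : {set {set edge N}}) (f : {set edge N} -> D),
    [/\ balanced_flows C f,
        feasible C f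
      & forall i j, req G i j -> aggR C f i j = rcap G i j].

Definition imbalance (i : 'I_N) : D :=
  \sum_(j | req G j i) rcap G j i - \sum_(j | req G i j) rcap G i j.

Definition total_imbalance : D := \sum_(i | 0 < imbalance i) imbalance i.

Lemma total_imbalanceE :
  total_imbalance = - \sum_(i | imbalance i < 0) imbalance i.
Proof.
apply/eqP; rewrite -subr_eq0 opprK; apply/eqP.
have sum0 : \sum_i imbalance i = 0.
  rewrite /imbalance sumrB (exchange_big_dep xpredT) //=.
  by rewrite subrr.
rewrite -[RHS]sum0 [RHS](bigID (fun i => 0 < imbalance i)) /=.
congr (_ + _); rewrite [RHS](bigID (fun i => imbalance i < 0)) /=.
rewrite [X in _ = _ + X]big1 ?addr0; last by move=> i; case: ltgtP.
by apply: eq_bigl => i; case: ltgtP.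
Qed.

End StarFlows.

Section MaxFlow.
Variables (D : realDomainType) (T : finType).
Variables (E : rel T) (cap : T -> T -> D) (s t : T).

Definition is_flow (g : T -> T -> D) : Prop :=
  (forall u v, E u v -> 0 <= g u v <= cap u v) /\
  (forall u, u != s -> u != t ->
     \sum_(v | E v u) g v u = \sum_(v | E u v) g u v).

Definition flow_value (g : T -> T -> D) : D :=
  \sum_(v | E s v) g s v - \sum_(v | E v s) g v s.

Definition is_max_flow_value (x : D) : Prop :=
  (exists2 g, is_flow g & flow_value g = x) /\
  (forall g, is_flow g -> flow_value g <= x).

End MaxFlow.

(* Nodes of the extended social graph: the users together with s and t. *)
Definition ext_node (N : nat) : finType := ('I_N + bool)%type.

Notation user i := (inl i) (only parsing).
Notation source := (inr false) (only parsing).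
Notation sink := (inr true) (only parsing).

Section ExtendedSocialGraph.
Variables (D : realDomainType) (N : nat) (G : srgraph D N).

Definition ext_edge (u v : ext_node N) : bool :=
  match u, v with
  | user i, user j => soc G i j
  | source, user i => 0 < imbalance G i
  | user i, sink => imbalance G i < 0
  | _, _ => false
  end.

(* The value 0 off the edges is never used. *)
Definition ext_cap (u v : ext_node N) : D :=
  match u, v with
  | user i, user j => scap G i j
  | source, user i => imbalance G i
  | user i, sink => - imbalance G i
  | _, _ => 0
  end.

Definition ext_max_flow_value (x : D) : Prop :=
  is_max_flow_value ext_edge ext_cap source sink x.

End ExtendedSocialGraph.

(* Main.v *)
(* The aggregate of balanced flows along cycles is a circulation, and conversely
   every nonnegative circulation is a sum of balanced flows along cycles in its
   support.  Once all requests are served, conservation at user i says that the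
   net social outflow of i is the imbalance P_i; this is what a flow in the
   extended graph that saturates all edges at s and t satisfies, and a flow of
   value P must saturate them. *)
Require Import Defs.
From mathcomp Require Import all_boot all_order all_algebra.
From mathcomp Require Import reals.
Set Implicit Arguments.
Unset Strict Implicit.
Unset Printing Implicit Defensive.
Import Order.TTheory GRing.Theory Num.Theory.
Local Open Scope ring_scope.

(** * Circulations on finite directed multigraphs and their decomposition into cycles *)

Section Circulation.
Variables (D : realDomainType) (V E : finType) (tl hd : E -> V).
Implicit Types (s : seq E) (h : E -> D) (v : V).

Let consecutive (e e' : E) := hd e == tl e'.

Definition conserved_at h v : Prop :=
  \sum_(e | tl e == v) h e = \sum_(e | hd e == v) h e.

Lemma map_head_cycle s : cycle consecutive s -> map hd s = rot 1 (map tl s).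
Proof.
case: s => //= e0 s; rewrite rot1_cons.
suff main e : path consecutive e (rcons s e0) ->
    hd e :: map hd s = rcons (map tl s) (tl e0) by exact: main.
elim: s e => [|e' s IHs] e /=; first by rewrite andbT => /eqP->.
by case/andP=> /eqP-> /IHs ->.
Qed.

(** The heads of a cyclic list of edges are a rotation of its tails, so each vertex occurs equally
    often among both. *)
Lemma cycle_conserved s (m : D) v :
    cycle consecutive s -> uniq (map tl s) ->
  \sum_(e in [set e in s] | tl e == v) m =
  \sum_(e in [set e in s] | hd e == v) m.
Proof.
move=> cyc_s uniq_s; have uniq_s' := map_uniq uniq_s.
have sumE (k : E -> V) :
    \sum_(e in [set e in s] | k e == v) m = \sum_(x <- map k s | x == v) m.
  rewrite big_map [RHS]big_mkcond big_uniq // -big_mkcondr.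
  by apply: eq_bigl => e; rewrite inE.
rewrite !sumE map_head_cycle //; apply: perm_big.
by rewrite perm_sym perm_rot.
Qed.

(** Conservation gives the head of an edge of positive value an outgoing edge of positive value, so
    a walk along such edges never gets stuck and, [V] being finite, closes up. The cycle found need
    not contain [e0]. *)
Lemma support_cycle h e0 :
    (forall e, 0 <= h e) -> (forall v, conserved_at h v) -> 0 < h e0 ->
  exists s, [/\ s != [::], cycle consecutive s, uniq (map tl s)
              & all (fun e => 0 < h e) s].
Proof.
move=> h_ge0 h_cons he0.
(* The default [e0] is returned only at inactive vertices, which the walk never meets. *)
pose out v := odflt e0 [pick e | (tl e == v) && (0 < h e)].
pose active v := [exists e, (tl e == v) && (0 < h e)].
have outP v : active v -> tl (out v) = v /\ 0 < h (out v).
  rewrite /out => /existsP[e He]; case: pickP => [e' /andP[/eqP ? ?] //|].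
  by move/(_ e); rewrite He.
have hd_active e : 0 < h e -> active (hd e).
  move=> he; apply: contraT; rewrite /active negb_exists => /forallP no_out.
  have : 0 < \sum_(e' | hd e' == hd e) h e'.
    rewrite (bigD1 e) //= ltr_pwDl //.
    by apply: sumr_ge0.
  rewrite -h_cons big1 ?ltxx // => e' e'P.
  have := no_out e'; rewrite e'P /= -leNgt => he'.
  by apply/eqP; rewrite eq_le he' h_ge0.
(* Following active out-edges makes [next] a function on vertices, so that any
   of its orbits that closes up visits each tail once. *)
pose next v := hd (out v).
have next_active v : active v -> active (next v).
  by case/outP=> _; apply: hd_active.
have iter_active k v : active v -> active (iter k next v).
  by move=> ?; elim: k => //= k; apply: next_active.
pose v0 := tl e0.
have v0_active : active v0 by apply/existsP; exists e0; rewrite eqxx.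
have /trajectP[k lt_k eq_k] := looping_order next v0.
pose w := iter k next v0.
have w_active : active w by apply: iter_active.
have cyc_w : fcycle next (orbit next w).
  (* It suffices that some positive iterate of [next] fixes [w]. The iterate of order
     [order next v0 - k] does; the witness is its predecessor. *)
  apply/(orbitPcycle 0 3).
  exists (order next v0 - k).-1.
  by rewrite prednK ?subn_gt0 // /w -iterD subnK 1?ltnW.
have orbit_active v : v \in orbit next w -> active v.
  by rewrite -fconnect_orbit => /iter_findex <-; apply: iter_active.
have tl_out : map tl (map out (orbit next w)) = orbit next w.
  rewrite -map_comp -[RHS]map_id; apply/eq_in_map => v /orbit_active.
  by case/outP.
exists (map out (orbit next w)); split.
- by rewrite -size_eq0 size_map size_orbit -lt0n order_gt0.
- rewrite cycle_map.
  apply: (sub_in_cycle (P := [in orbit next w])) cyc_w; last exact/allP.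
  move=> v v' _ /orbit_active/outP[tl_v' _] /eqP eq_v'.
  by rewrite /= /consecutive tl_v' -eq_v'.
- by rewrite tl_out orbit_uniq.
- by apply/allP=> _ /mapP[v /orbit_active/outP[_ hv] ->].
Qed.

(** Induction on the size of the support: subtracting the minimum [m] of [h] along a cycle in the
    support preserves nonnegativity and conservation, and removes an edge from the support. No
    division occurs, so integral circulations get integral cycle values. *)
Lemma circulation_decomposition h :
    (forall e, 0 <= h e) -> (forall v, conserved_at h v) ->
  exists f : {set E} -> D,
    [/\ forall c, 0 <= f c,
        forall c, f c != 0 -> exists s,
          [/\ c = [set e in s], s != [::], cycle consecutive s,
              uniq (map tl s) & all (fun e => 0 < h e) s]
      & forall e, h e = \sum_(c : {set E} | e \in c) f c].
Proof.
have [n] := ubnP #|[set e | h e != 0]|.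
elim: n h => // n IHn h; rewrite ltnS => le_n h_ge0 h_cons.
have [e0 he0|h0] := pickP (fun e => h e != 0); last first.
  exists (fun=> 0); split=> // [c|e]; first by rewrite eqxx.
  by rewrite big1 //; apply/eqP; rewrite -[_ == _]negbK h0.
have {}he0 : 0 < h e0 by rewrite lt_neqAle eq_sym he0 h_ge0.
have [s [s_neq0 cyc_s uniq_s pos_s]] := support_cycle h_ge0 h_cons he0.
pose c0 := [set e in s].
have [e1 e1_s] : exists e1, e1 \in s.
  by case: (s) s_neq0 => // e s' _; exists e; apply: mem_head.
have e1_c0 : e1 \in c0 by rewrite inE.
case: (@arg_minP _ _ _ e1 [in c0] h e1_c0) => em em_c0 h_min; set m := h em in h_min.
have m_gt0 : 0 < m by apply: (allP pos_s); move: em_c0; rewrite !inE.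
pose h' e := h e - (if e \in c0 then m else 0).
have h'_ge0 e : 0 <= h' e.
  by rewrite subr_ge0; case: ifP => // /h_min.
have h'_le e : h' e <= h e.
  by rewrite gerBl; case: ifP => // _; apply: ltW.
have h'_cons v : conserved_at h' v.
  rewrite /conserved_at !sumrB h_cons; congr (_ - _).
  rewrite -!big_mkcondr /=; have := cycle_conserved m v cyc_s uniq_s.
  by congr (_ = _); apply: eq_bigl => e; rewrite andbC.
have lt_h' : (#|[set e | (h' e != 0)%R]| < n)%N.
  apply: leq_trans le_n; apply: proper_card; apply/properP; split.
    apply/subsetP=> e; rewrite !inE; apply: contra => /eqP he.
    by rewrite eq_le h'_ge0 (le_trans (h'_le e)) ?he.
  exists em; first by rewrite inE gt_eqF.
  by rewrite inE negbK subr_eq0 ifT.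
have [f [f_ge0 f_cyc hE]] := IHn h' lt_h' h'_ge0 h'_cons.
exists (fun c => f c + (if c == c0 then m else 0)); split.
- by move=> c; rewrite addr_ge0 //; case: ifP => // _; apply: ltW.
- move=> c; case: (c =P c0) => [-> _|_]; first by exists s.
  rewrite addr0 => /f_cyc[s' [-> ? ? ? /allP pos_s']].
  exists s'; split=> //; apply/allP=> e /pos_s' h'e.
  exact: lt_le_trans (h'_le e).
- move=> e; rewrite big_split /= -hE -big_mkcondr /=.
  suff -> : \sum_(c : {set E} | (e \in c) && (c == c0)) m
      = if e \in c0 then m else 0 by rewrite subrK.
  case: ifP => e_c0.
    rewrite (big_pred1 c0) // => c /=.
    by case: (c =P c0) => [->|_]; rewrite ?e_c0 ?andbF.
  rewrite big_pred0 // => c.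
  by case: (c =P c0) => [->|_]; rewrite ?e_c0 ?andbF.
Qed.

End Circulation.

(** * Conservation laws for flows on the social-request graph *)

Section StarFlow.
Variables (D : realDomainType) (N : nat) (G : srgraph D N).
Implicit Types (i j : 'I_N) (e : edge N).

Let tail := @tail_node N.
Let head := @head_node N.

Lemma sum_pair_fst (I J : finType) (F : I * J -> D) (i : I) :
  \sum_(p | p.1 == i) F p = \sum_j F (i, j).
Proof.
rewrite (partition_big snd xpredT) //=; apply: eq_bigr => j _.
by rewrite (big_pred1 (i, j)).
Qed.

Lemma sum_pair_snd (I J : finType) (F : I * J -> D) (j : J) :
  \sum_(p | p.2 == j) F p = \sum_i F (i, j).
Proof.
rewrite (partition_big fst xpredT) //=; apply: eq_bigr => i _.
by rewrite (big_pred1 (i, j)) // => p; rewrite andbC.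
Qed.

Lemma sum_out_edges (h : edge N -> D) i :
  \sum_(e | tail e == i) h e =
  \sum_j h (inl (i, j)) + \sum_j h (inr (i, j)).
Proof.
rewrite big_sumType /= -!(sum_pair_fst (fun p => h (_ p))).
by congr (_ + _); apply: eq_bigl; case.
Qed.

Lemma sum_in_edges (h : edge N -> D) i :
  \sum_(e | head e == i) h e =
  \sum_j h (inl (j, i)) + \sum_j h (inr (j, i)).
Proof.
rewrite big_sumType /= -!(sum_pair_snd (fun p => h (_ p))).
by congr (_ + _); apply: eq_bigl; case.
Qed.

(** When request edges carry exactly their capacities, the request terms of the conservation law
    differ by the imbalance. *)
Lemma conserved_imbalance (h : edge N -> D) i :
    (forall j k, h (inr (j, k)) = if req G j k then rcap G j k else 0) ->
  conserved_at tail head h i <->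
  \sum_j h (inl (i, j)) = \sum_j h (inl (j, i)) + imbalance G i.
Proof.
move=> hR; rewrite /conserved_at sum_out_edges sum_in_edges /imbalance.
rewrite !(eq_bigr _ (fun j _ => hR _ _)) -!big_mkcond /= addrA.
by split=> [<-|->]; rewrite ?addrK ?subrK.
Qed.

Lemma star_cycle_in_graph (c : {set edge N}) e :
  star_cycle G c -> e \in c -> in_graph G e.
Proof.
by case=> s [-> _ _ _ /allP s_in]; rewrite inE => /s_in/andP[].
Qed.

Lemma star_cycle_conserved (c : {set edge N}) (m : D) i :
    star_cycle G c ->
  \sum_(e in c | tail e == i) m = \sum_(e in c | head e == i) m.
Proof. by case=> s [-> _ cyc_s uniq_s _]; apply: cycle_conserved. Qed.

(** Conservation is linear in the flow, so it passes from each single cycle to the sum over [C]. *)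
Lemma aggregate_conserved (C : {set {set edge N}}) f i :
    balanced_flows G C f ->
  conserved_at tail head (fun e => \sum_(c in C | e \in c) f c) i.
Proof.
move=> bal; rewrite /conserved_at.
rewrite (exchange_big_dep [in C]) /=; last by move=> e c _ /andP[].
rewrite [RHS](exchange_big_dep [in C]) /=; last by move=> e c _ /andP[].
apply: eq_bigr => c cC; have [star_c _] := bal c cC.
have := star_cycle_conserved (f c) i star_c.
by congr (_ = _); apply: eq_bigl => e; rewrite cC andbC.
Qed.

Lemma aggregate_off_graph (C : {set {set edge N}}) f e :
    balanced_flows G C f -> ~~ in_graph G e ->
  \sum_(c in C | e \in c) f c = 0.
Proof.
move=> bal /negP eG; rewrite big1 // => c /andP[/bal[star_c _] e_c].
by case: eG; apply: star_cycle_in_graph e_c.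
Qed.

(** * Flows in the extended social graph *)

Section ExtendedSums.
Variable g : ext_node N -> ext_node N -> D.

Lemma sum_ext_in i :
  \sum_(v | ext_edge G v (inl i)) g v (inl i) =
  \sum_(j | soc G j i) g (inl j) (inl i)
    + (if 0 < imbalance G i then g (inr false) (inl i) else 0).
Proof. by rewrite big_sumType /= [X in _ + X]big_mkcond big_bool /= add0r. Qed.

Lemma sum_ext_out i :
  \sum_(v | ext_edge G (inl i) v) g (inl i) v =
  \sum_(j | soc G i j) g (inl i) (inl j)
    + (if imbalance G i < 0 then g (inl i) (inr true) else 0).
Proof. by rewrite big_sumType /= [X in _ + X]big_mkcond big_bool /= addr0. Qed.

Lemma ext_flow_value :
  flow_value (ext_edge G) (inr false) g =
  \sum_(i | 0 < imbalance G i) g (inr false) (inl i).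
Proof.
rewrite /flow_value [X in _ - X]big_pred0 ?subr0; last by case=> [i|[]].
by rewrite big_sumType /= [X in _ + X]big_pred0 ?addr0 //; case.
Qed.

End ExtendedSums.

(** The edges leaving the source form a cut of capacity [total_imbalance G]. *)
Lemma ext_flow_value_le g :
    is_flow (ext_edge G) (ext_cap G) (inr false) (inr true) g ->
  flow_value (ext_edge G) (inr false) g <= total_imbalance G.
Proof.
case=> g_cap _; rewrite ext_flow_value; apply: ler_sum => i i_gt0.
by have /andP[] := g_cap (inr false) (inl i) i_gt0.
Qed.

Lemma flow_saturated (P : pred 'I_N) (x y : 'I_N -> D) :
    (forall i, P i -> x i <= y i) ->
    \sum_(i | P i) x i = \sum_(i | P i) y i ->
  forall i, P i -> x i = y i.
Proof.
move=> le_xy eq_sum i Pi; apply/eqP; rewrite eq_sym -subr_eq0.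
apply/eqP; apply: (psumr_eq0P (F := fun j => y j - x j) _ _ Pi).
  by move=> j /le_xy; rewrite subr_ge0.
by rewrite sumrB eq_sum subrr.
Qed.

(** Equality in the cut bound saturates every source edge. Conservation summed over all users, where
    the social terms cancel, shows that the sink edges carry the same total, so they are saturated
    too. *)
Lemma max_ext_flow_conserved g :
    is_flow (ext_edge G) (ext_cap G) (inr false) (inr true) g ->
    flow_value (ext_edge G) (inr false) g = total_imbalance G ->
  forall i, \sum_(j | soc G i j) g (inl i) (inl j) =
    \sum_(j | soc G j i) g (inl j) (inl i) + imbalance G i.
Proof.
case=> g_cap g_cons; rewrite ext_flow_value => val_g i.
have cons j := g_cons (inl j) isT isT.
have g_src j : 0 < imbalance G j -> g (inr false) (inl j) = imbalance G j.
  apply: flow_saturated val_g j => j j_gt0.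
  by have /andP[] := g_cap (inr false) (inl j) j_gt0.
have sum_snk : \sum_(j | imbalance G j < 0) g (inl j) (inr true)
    = \sum_(j | imbalance G j < 0) - imbalance G j.
  rewrite sumrN -total_imbalanceE -val_g.
  have : \sum_j \sum_(v | ext_edge G v (inl j)) g v (inl j)
      = \sum_j \sum_(v | ext_edge G (inl j) v) g (inl j) v by apply: eq_bigr.
  rewrite (eq_bigr _ (fun j _ => sum_ext_in g j)).
  rewrite [RHS](eq_bigr _ (fun j _ => sum_ext_out g j)) !big_split /=.
  rewrite -!big_mkcond /= (exchange_big_dep xpredT) //=.
  by move/addrI.
have g_snk j : imbalance G j < 0 -> g (inl j) (inr true) = - imbalance G j.
  apply: flow_saturated sum_snk j => j j_lt0.
  by have /andP[] := g_cap (inl j) (inr true) j_lt0.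
have := cons i; rewrite sum_ext_in sum_ext_out.
case: ltgtP (g_src i) (g_snk i) => [_ /(_ isT)-> _|_ _ /(_ isT)->|<- _ _] /=.
- by rewrite addr0.
- by rewrite addr0 => ->; rewrite addrNK.
- by rewrite !addr0.
Qed.

(** The net social amounts extend to a flow that saturates the source and sink edges; the cut bound
    makes it maximal. *)
Lemma satisfiable_max_flow :
  all_requests_satisfiable G -> ext_max_flow_value G (total_imbalance G).
Proof.
case=> C [f [bal [feasS feasR] satR]]; split; last exact: ext_flow_value_le.
(* [A] records the gross amount on each edge, without the cancellation of opposite social edges in
   [aggS], so that edgewise conservation applies to it. *)
pose A e := \sum_(c in C | e \in c) f c.
have A_soc i j : ~~ soc G i j -> A (inl (i, j)) = 0.
  by move=> ij; apply: aggregate_off_graph.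
have A_req i j : A (inr (i, j)) = if req G i j then rcap G i j else 0.
  case: ifPn => ij; first exact: satR.
  exact: aggregate_off_graph.
have A_bal i : \sum_j A (inl (i, j)) = \sum_j A (inl (j, i)) + imbalance G i.
  by apply/conserved_imbalance => //; apply: aggregate_conserved.
(* A flow must be nonnegative while [aggS] is signed: the positive parts on an edge and on its
   reverse differ by [aggS]. *)
pose g (u v : ext_node N) := match u, v with
  | inl i, inl j => Num.max 0 (aggS C f i j)
  | inr false, inl i => imbalance G i
  | inl i, inr true => - imbalance G i
  | _, _ => 0 end.
have net i : \sum_(j | soc G i j) g (inl i) (inl j)
    = \sum_(j | soc G j i) g (inl j) (inl i) + imbalance G i.
  apply/eqP; rewrite addrC -subr_eq; apply/eqP.
  rewrite (eq_bigl _ _ (fun j => soc_sym G j i)) -sumrB.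
  rewrite (eq_bigr (fun j => aggS C f i j)); last first.
    move=> j _; rewrite /g.
    have -> : aggS C f j i = - aggS C f i j by rewrite /aggS opprB.
    rewrite !maxEle oppr_ge0; case: ltgtP => [_|_|<-].
    - by rewrite subr0.
    - by rewrite sub0r opprK.
    - by rewrite oppr0 subrr.
  rewrite big_mkcond (eq_bigr (fun j => A (inl (i, j)) - A (inl (j, i)))).
    by rewrite sumrB A_bal addrAC subrr add0r.
  move=> j _; case: ifPn => // ij.
  by rewrite !A_soc ?subrr // soc_sym.
exists g; last by rewrite ext_flow_value.
split=> [[i|[]] [j|[]] //=|[i|[]] // _ _].
- move=> ij; rewrite le_max lexx /= ge_max scap_ge0 //.
  by have [/andP[]] := feasS i j ij.
- by move=> i_lt0; rewrite oppr_ge0 ltW /=.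
- by move=> j_gt0; rewrite ltW /=.
- rewrite sum_ext_in sum_ext_out net -addrA; congr (_ + _).
  by rewrite /g; case: ltgtP => [_|_|<-]; rewrite ?addr0 ?subrr.
Qed.

(** The social part of the flow together with fully served requests is a circulation. Its cycles use
    only edges of positive value, hence of positive capacity, and so are STAR cycles. *)
Lemma max_flow_satisfiable :
  ext_max_flow_value G (total_imbalance G) -> all_requests_satisfiable G.
Proof.
case=> [[g g_flow val_g] _].
have net := max_ext_flow_conserved g_flow val_g.
have [g_cap _] := g_flow.
(* The request edges replace the source and sink edges, contributing the same imbalance at every
   user. *)
pose h (e : edge N) : D := match e with
  | inl (i, j) => if soc G i j then g (inl i) (inl j) else 0
  | inr (i, j) => if req G i j then rcap G i j else 0 end.
have h_soc i j : soc G i j -> 0 <= h (inl (i, j)) <= scap G i j.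
  by move=> ij; rewrite /h ij; apply: (g_cap (inl i) (inl j)).
have h_ge0 e : 0 <= h e.
  case: e => [[i j]|[i j]] /=; case: ifP => // ij.
    by have /andP[] := g_cap (inl i) (inl j) ij.
  by apply/ltW/rcap_gt0.
have h_cons i : conserved_at tail head h i.
  by apply/conserved_imbalance => //; rewrite -!big_mkcond net.
have h_pos e : 0 < h e -> in_graph G e && (0 < capacity G e).
  case: e => [[i j]|[i j]] /=; case: ifP => [ij|]; rewrite ?ltxx //= => h_gt0.
  by apply: lt_le_trans h_gt0 _; have /andP[] := g_cap (inl i) (inl j) ij.
have [f [f_ge0 f_cyc hE]] := circulation_decomposition h_ge0 h_cons.
pose C := [set c | f c != 0].
have AE e : \sum_(c in C | e \in c) f c = h e.
  rewrite hE [RHS](bigID [in C]) /= [X in _ = _ + X]big1 ?addr0.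
    by apply: eq_bigl => c; rewrite andbC.
  by move=> c /andP[_]; rewrite inE negbK => /eqP.
have aggSE i j : aggS C f i j = h (inl (i, j)) - h (inl (j, i)).
  by rewrite /aggS !AE.
have aggRE i j : req G i j -> aggR C f i j = rcap G i j.
  by move=> ij; rewrite /aggR AE /= ij.
exists C, f; split=> //.
  move=> c; rewrite inE => /f_cyc[s [cE s_neq0 cyc_s uniq_s pos_s]].
  by split=> //; exists s; split=> //; apply: sub_all pos_s.
split=> [i j ij|i j ij]; last by rewrite aggRE // lexx ltW ?rcap_gt0.
(* Opposite social edges may both carry flow; each amount lies between 0 and its own capacity, which
   bounds the difference on both sides. *)
have /andP[ge_ij le_ij] := h_soc i j ij.
have ji : soc G j i by rewrite soc_sym.
have /andP[ge_ji le_ji] := h_soc j i ji.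
rewrite !aggSE opprB; split=> //; apply/andP; split.
  by rewrite -[leLHS]add0r lerB.
by rewrite -[leRHS]subr0 lerB.
Qed.

End StarFlow.

Theorem theorem1 (R : realType) (k : service) (N : nat)
    (G : srgraph (amount R k) N) :
  all_requests_satisfiable G <-> ext_max_flow_value G (total_imbalance G).
Proof.
split; [exact: satisfiable_max_flow | exact: max_flow_satisfiable].
Qed.
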